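(* Let $a$ and $d$ be positive integers and let $n\ge 0$ be an integer. Then there exists an oriented bipartite graph with score set $A=\{a, a+d, a+2d,\dots, a+nd\}$.
   Context: An oriented bipartite graph $D(U,V)$ is obtained by assigning a direction to each edge of a simple bipartite graph with parts $U=\{u_1,\dots,u_m\}$ and $V=\{v_1,\dots,v_n\}$. For a vertex $x$, let $d_x^+$ and $d_x^-$ denote its outdegree and indegree. The score of $u\in U$ is $a_u=n+d_u^+-d_u^-$ and the score of $v\in V$ is $b_v=m+d_v^+-d_v^-$. The score set of $D(U,V)$ is the set of distinct scores of all its vertices. *)

(* Defs.v *)
From mathcomp Require Import all_boot all_order all_algebra.

Set Implicit Arguments.
Unset Strict Implicit.
Unset Printing Implicit Defensive.

Import GRing.Theory.
Local Open Scope ring_scope.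

(* A simple bipartite graph with parts U = 'I_p and V = 'I_q, together with a
   direction for each edge: [toV u v] says that the edge uv goes from u to v,
   and otherwise it goes from v to u. The value of [toV] at a non-adjacent pair
   is never used. *)
Record oriented_bigraph (p q : nat) := OrientedBigraph {
  adj : 'I_p -> 'I_q -> bool;
  toV : 'I_p -> 'I_q -> bool
}.

Section Scores.
Variables (p q : nat) (D : oriented_bigraph p q).

Definition vertex : finType := ('I_p + 'I_q)%type.

Definition arc (x y : vertex) : bool :=
  match x, y with
  | inl u, inr v => adj D u v && toV D u v
  | inr v, inl u => adj D u v && ~~ toV D u v
  | _, _ => false
  end.

Definition outdeg (x : vertex) : nat := #|[set y | arc x y]|.

Definition indeg (x : vertex) : nat := #|[set y | arc y x]|.

Definition opposite_size (x : vertex) : nat :=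
  match x with inl _ => q | inr _ => p end.

Definition score (x : vertex) : int :=
  (opposite_size x)%:Z + (outdeg x)%:Z - (indeg x)%:Z.

Definition score_set : seq int := undup [seq score x | x <- enum vertex].

End Scores.

(* Main.v *)
Require Import Defs.
From mathcomp Require Import all_boot all_order all_algebra.
From mathcomp Require Import zify.

(* An oriented bipartite graph is a p x q matrix K with entries in {0, 1, 2}: the
   scores in V are the column sums, and those in U are 2q minus the row sums.
   Any row sums at most 2q whose total is q * c are realised with all column
   sums equal to c. With c = N = a + n * d, the row sums 2q - (a + i * d), i < n, total
   at most q * N, and it remains to reach q * N by adding rows of the small sums
   r = 2q - N or r + d:
   - N odd: r = 1, repeating rows of sum 1;
   - N even, d = 1 and n > 0: r = 0, repeating rows of sum d = 1;
   - N even otherwise: r = 2, repeating rows of sum 2, plus one row of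
     sum d + 2 when parity requires it. *)

Lemma card_arc_row (p q : nat) (P : pred 'I_q) (e : pred ('I_p + 'I_q)%type) :
  (forall u, e (inl u) = false) -> (forall v, e (inr v) = P v) ->
  #|[set y | e y]| = \sum_(v < q) P v.
Proof.
move=> e_l e_r; rewrite cardsE -sum1_card big_mkcond big_sumType /=.
rewrite big1 => [|u _]; last by rewrite unfold_in e_l.
by rewrite add0n; apply: eq_bigr => v _; rewrite unfold_in e_r; case: (P v).
Qed.

Lemma card_arc_col (p q : nat) (P : pred 'I_p) (e : pred ('I_p + 'I_q)%type) :
  (forall v, e (inr v) = false) -> (forall u, e (inl u) = P u) ->
  #|[set y | e y]| = \sum_(u < p) P u.
Proof.
move=> e_r e_l; rewrite cardsE -sum1_card big_mkcond big_sumType /=.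
rewrite [X in (_ + X)%N]big1 => [|u _]; last by rewrite unfold_in e_r.
by rewrite addn0; apply: eq_bigr => v _; rewrite unfold_in e_l; case: (P v).
Qed.

(* [K u v] is the contribution of the pair [uv] to the score of [v]; the
   contribution to the score of [u] is then [2 - K u v]. *)
Definition bigraph_of_matrix (p q : nat) (K : 'I_p -> 'I_q -> nat) :=
  OrientedBigraph (fun u v => K u v != 1) (fun u v => K u v == 0).

Lemma score_matrix_row {p q : nat} {K : 'I_p -> 'I_q -> nat} (u : 'I_p) :
  (forall u v, K u v <= 2) ->
  score (bigraph_of_matrix p q K) (inl u) = ((2 * q)%:Z - (\sum_v K u v)%:Z)%R.
Proof.
move=> K2; rewrite /score /outdeg /indeg /=.
rewrite (card_arc_row _ _ (fun v => K u v == 0)) //; last first.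
  by move=> v /=; case: (K u v) => [|[]].
rewrite (card_arc_row _ _ (fun v => K u v == 2)) //; last first.
  by move=> v /=; case: (K u v) (K2 u v) => [|[|[]]].
suff: q + \sum_v (K u v == 0) + \sum_v K u v = 2 * q + \sum_v (K u v == 2).
  by move=> /=; lia.
have card_q : q = \sum_(v < q) 1 by rewrite sum1_card card_ord.
rewrite [X in X + _ + _]card_q [X in 2 * X]card_q big_distrr -!big_split /=; apply: eq_bigr => v _.
by case: (K u v) (K2 u v) => [|[|[]]].
Qed.

Lemma score_matrix_col {p q : nat} {K : 'I_p -> 'I_q -> nat} (v : 'I_q) :
  (forall u v, K u v <= 2) ->
  score (bigraph_of_matrix p q K) (inr v) = Posz (\sum_u K u v).
Proof.
move=> K2; rewrite /score /outdeg /indeg /=.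
rewrite (card_arc_col _ _ (fun u => K u v == 2)) //; last first.
  by move=> u /=; case: (K u v) (K2 u v) => [|[|[]]].
rewrite (card_arc_col _ _ (fun u => K u v == 0)) //; last first.
  by move=> u /=; case: (K u v) => [|[]].
suff: p + \sum_u (K u v == 2) = \sum_u K u v + \sum_u (K u v == 0).
  by move=> /=; lia.
have card_p : p = \sum_(u < p) 1 by rewrite sum1_card card_ord.
rewrite [X in X + _ = _]card_p -!big_split /=; apply: eq_bigr => u _.
by case: (K u v) (K2 u v) => [|[|[]]].
Qed.

(** Raising [P] by one slides the window of [q] consecutive quotients: [P %/ q] drops out and
    [(P + q) %/ q], larger by one, comes in. *)
Lemma sum_divn_shift (P q : nat) : 0 < q -> \sum_(v < q) ((P + v) %/ q) = P.
Proof.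
case: q => // q _; elim: P => [|P IH].
  by rewrite big1 // => v _; rewrite add0n divn_small.
have := erefl (\sum_(v < q.+2) ((P + v) %/ q.+1)).
rewrite [LHS]big_ord_recl [RHS]big_ord_recr /= IH addn0 divnDr // divnn addn1.
rewrite addnS addnC => /(congr1 (subn^~ (P %/ q.+1))).
rewrite addnK -addSn addnK => {2}<-.
by apply: eq_bigr => v _; rewrite addSnnS.
Qed.

(* Row [u] claims the next [nth 0 s u] units in a cyclic enumeration of the
   columns, so that the columns fill up evenly. *)
Lemma balanced_matrix (q c : nat) (s : seq nat) :
  0 < q -> all (leq^~ (2 * q)) s -> sumn s = q * c ->
  exists K : 'I_(size s) -> 'I_q -> nat,
    [/\ forall u v, K u v <= 2,
        forall u, \sum_v K u v = nth 0 s u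
      & forall v, \sum_u K u v = c].
Proof.
move=> q0 s_le sum_s; pose P u := sumn (take u s).
have PS u : u < size s -> P u.+1 = P u + nth 0 s u.
  by move=> us; rewrite /P (take_nth 0 us) sumn_rcons.
have leP u v : u < size s -> (P u + v) %/ q <= (P u.+1 + v) %/ q.
  by move=> us; rewrite leq_div2r // PS // leq_add2r leq_addr.
(* The entry counts the multiples of [q] in the interval from [P u + v] (excluded) to [P u.+1 + v]
   (included). Its length is at most [2 * q], so there are at most two. *)
exists (fun u v => (P u.+1 + v) %/ q - (P u + v) %/ q); split.
- move=> u v; rewrite leq_subLR.
  rewrite [leqRHS](_ : _ = (2 * q + (P u + v)) %/ q); last first.
    by rewrite divnMDl // addnC.
  by rewrite leq_div2r // PS // addnAC addnC leq_add2r (allP s_le) ?mem_nth.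
- move=> u; rewrite sumnB => [|v _]; last exact: leP.
  by rewrite !sum_divn_shift // PS // addKn.
- move=> v; have tele k : k <= size s ->
      \sum_(u < k) ((P u.+1 + v) %/ q - (P u + v) %/ q) = (P k + v) %/ q.
    elim: k => [|k IH] ks.
      by rewrite big_ord0 /P take0 add0n divn_small.
    by rewrite big_ord_recr /= IH ?subnKC ?leP // ltnW.
  by rewrite tele // /P take_size sum_s mulnC divnMDl // divn_small ?addn0.
Qed.

Lemma constant_side_score_set (q c : nat) (s : seq nat) :
  0 < q -> all (leq^~ (2 * q)) s -> sumn s = q * c ->
  exists D : oriented_bigraph (size s) q,
    score_set D =i Posz c :: [seq Posz (2 * q - t) | t <- s].
Proof.
move=> q0 s_le sum_s; have [K [K2 Krow Kcol]] := balanced_matrix q c s q0 s_le sum_s.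
exists (bigraph_of_matrix _ _ K) => z; rewrite mem_undup inE.
have row u : score (bigraph_of_matrix _ _ K) (inl u) = Posz (2 * q - nth 0 s u).
  by rewrite score_matrix_row // Krow subzn // (allP s_le) ?mem_nth.
have col v : score (bigraph_of_matrix _ _ K) (inr v) = Posz c.
  by rewrite score_matrix_col // Kcol.
apply/mapP/orP => [[[u|v] _ ->]|[/eqP->|/mapP[t ts ->]]].
- by right; rewrite row; apply/mapP; exists (nth 0 s u); rewrite ?mem_nth.
- by left; rewrite col.
(* [q0] provides a vertex of V, so [c] does occur as a score. *)
- by exists (inr (Ordinal q0)); rewrite ?mem_enum ?col.
- rewrite -index_mem in ts; exists (inl (Ordinal ts)); rewrite ?mem_enum //.
  by rewrite row /= nth_index // -index_mem.
Qed.

Lemma sumn_progression (r d n : nat) :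
  2 * sumn [seq r + (n - i) * d | i <- iota 0 n] = 2 * (n * r) + n * n.+1 * d.
Proof.
rewrite sumnE big_map -[in iota 0 n](subn0 n) big_nat_rev /=.
rewrite (eq_big_nat _ _ (F2 := fun i => r + i.+1 * d)); last first.
  by move=> i /andP[_ lt_in]; congr (_ + _ * d); lia.
elim: n => [|n IH]; first by rewrite big_geq.
by rewrite big_nat_recr //= mulnDr IH; nia.
Qed.

(* A vertex of U with row sum [t] has score [2 * q - t], so the last equation
   (doubled, to avoid halving [n * n.+1]) counts [K] by rows and by columns: one
   row of sum [r + (n - i) * d] for each [i < n], plus [x] rows of sum [r] and
   [y] rows of sum [r + d]; every column has sum [a + n * d]. *)
Lemma progression_of_padding (a d n q r x y : nat) :
  0 < q -> 2 * q = a + n * d + r -> (0 < y -> 0 < n) ->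
  2 * (n * r) + n * n.+1 * d + 2 * (x * r) + 2 * (y * (r + d)) =
    2 * q * (a + n * d) ->
  exists (p q : nat) (D : oriented_bigraph p q),
    score_set D =i [seq Posz (a + i * d)%N | i <- iota 0 n.+1].
Proof.
move=> q0 def_q y_n total.
pose s := [seq r + (n - i) * d | i <- iota 0 n] ++ nseq x r ++ nseq y (r + d).
have sP t : t \in s -> exists2 i, i <= n & t = r + (n - i) * d.
  rewrite !mem_cat !mem_nseq => /or3P[/mapP[i]|/andP[_ /eqP->]|/andP[y0 /eqP->]].
  - by rewrite mem_iota => /andP[_ lt_in] ->; exists i => //; rewrite ltnW.
  - by exists n; rewrite // subnn addn0.
  (* A row of sum [r + d] repeats the progression at [i = n - 1], whence the condition [0 < n]. *)
  - exists n.-1; first exact: leq_pred.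
    by rewrite -{1}(prednK (y_n y0)) subSnn mul1n.
have comp i : i <= n -> r + (n - i) * d <= 2 * q /\
    2 * q - (r + (n - i) * d) = a + i * d.
  by move=> le_in; rewrite def_q mulnBl; have := leq_mul le_in (leqnn d); lia.
have s_le : all (leq^~ (2 * q)) s.
  by apply/allP => t /sP[i /comp[le_t _] ->].
have sum_s : sumn s = q * (a + n * d).
  apply/eqP; rewrite -(eqn_pmul2l (isT : 0 < 2)) [2 * (q * _)]mulnA -total.
  by rewrite !sumn_cat !sumn_nseq !mulnDr sumn_progression; apply/eqP; lia.
have [D scoreD] := constant_side_score_set q _ s q0 s_le sum_s.
exists (size s), q, D => z; rewrite scoreD inE.
apply/orP/mapP => [[/eqP->|/mapP[t /sP[i le_in ->] ->]]|[i]].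
- by exists n; rewrite // mem_iota ltnS leqnn.
- by exists i; rewrite ?mem_iota ?ltnS // (comp i le_in).2.
(* The top score [a + n * d] is taken from V, since [x] may be 0 and then no row need have sum
   [r]. *)
rewrite mem_iota add0n ltnS [i <= n]leq_eqVlt => /andP[_ /predU1P[->|lt_in]] ->.
  by left.
right; apply/mapP; exists (r + (n - i) * d); last by rewrite (comp i (ltnW lt_in)).2.
by rewrite mem_cat (map_f (fun i => r + (n - i) * d)) // mem_iota.
Qed.

Theorem theorem2p4 (a d n : nat) (ha : (0 < a)%N) (hd : (0 < d)%N) :
  exists (p q : nat) (D : oriented_bigraph p q),
    score_set D =i [seq Posz (a + i * d)%N | i <- iota 0 n.+1].
Proof.
have even_pronic k : exists h, k * k.+1 = 2 * h.
  by exists 'C(k.+1, 2); rewrite bin2 mul2n even_halfK /= mulnC // oddM /=; case: odd.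
have [h hn] := even_pronic n.
pose N := a + n * d; have [k defN] : exists k, N = 2 * k + 1 \/ N = 2 * k.
  by exists N./2; have := odd_double_half N; case: (odd N); lia.
(* Strict because [a] is positive. This and the next bounds ensure that the number of padding rows
   is not negative. *)
have le_nd : n * d < N by rewrite /N; lia.
have le_n_nd : n <= n * d by rewrite leq_pmulr.
have le_sq : n * (n * d) <= (n * d) * (n * d) by rewrite leq_mul2r le_n_nd orbT.
have le_N1 : (n * d).+1 * (n * d).+1 <= N * N by rewrite leq_mul.
case: defN => defN.
  have le_x : n + h * d <= k.+1 * N by nia.
  apply: (progression_of_padding a d n k.+1 1 (k.+1 * N - (n + h * d)) 0) => //.
    by rewrite -/N; lia.
  by rewrite -/N hn; nia.
have [/andP[n0 /eqP d1]|dn] := boolP ((0 < n) && (d == 1)).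
  have le_x : h <= k * N by subst d; nia.
  apply: (progression_of_padding a d n k 0 0 (k * N - h)) => //.
  - by lia.
  - by rewrite -/N; lia.
  by rewrite -/N hn d1; lia.
(* With [q = k.+1] and [N = 2 * k], the total [q * N] is [4 * g]. Rows of sum 2 can fill the gap
   exactly when [h * d] is even. *)
have [g kg] := even_pronic k.
have def_q : 2 * k.+1 = a + n * d + 2 by rewrite -/N; lia.
have [odd_hd|even_hd] := boolP (odd (h * d)).
  have n0 : 0 < n by move: odd_hd; case: (n) hn => //; case: (h).
  have d3 : 3 <= d.
    by move: odd_hd dn; rewrite n0 oddM => /andP[_]; case: (d) => [|[|[]]].
  have le_n3 : 3 * n <= n * d by rewrite mulnC leq_mul.
  have le_d : d <= n * d by rewrite leq_pmull.
  have le_sq3 : 3 * n * (n * d) <= (n * d) * (n * d) by rewrite leq_mul.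
  have le_nM : n * d <= n * (n * d) by rewrite leq_pmull.
  have le_x : 2 * n + h * d + (2 + d) <= 4 * g by nia.
  have [x def_x] : exists x, 2 * n + h * d + (2 + d) + 2 * x = 4 * g.
    have := odd_double_half (h * d); have := odd_double_half d.
    move: (odd_hd); rewrite oddM => /[dup] /andP[-> ->].
    (* The final 2 is half of the constant 2 plus the two remainders of the odd numbers [h * d] and
       [d]. *)
    by exists (2 * g - n - (h * d)./2 - d./2 - 2); lia.
  apply: (progression_of_padding a d n k.+1 2 x 1) => //.
  by rewrite -/N hn; nia.
have le_x : 2 * n + h * d <= 4 * g.
  case: (posnP n) => [n0|n0]; first by subst n; nia.
  have d2 : 2 <= d by move: dn; rewrite n0; lia.
  have le_n2 : 2 * n <= n * d by rewrite mulnC leq_mul.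
  by nia.
have [x def_x] : exists x, 2 * n + h * d + 2 * x = 4 * g.
  have := odd_double_half (h * d); rewrite (negbTE even_hd).
  by exists (2 * g - n - (h * d)./2); lia.
apply: (progression_of_padding a d n k.+1 2 x 0) => //.
by rewrite -/N hn; nia.
Qed.
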